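(* Let $\mathcal{H}$ be a complex Hilbert space and $n\ge 1$. For all bounded linear operators $A_1,A_2,\dots,A_n$ on $\mathcal{H}$, $$\frac{1}{\sqrt{n!}}\sup_{x\in\mathcal{H},\ \|x\|=1}\bigl\{\|A_1x\|\,\|A_2x\|\cdots\|A_nx\|\bigr\}\le\|A_1\odot A_2\odot\cdots\odot A_n\|.$$
   Context: $\mathcal{H}^{\otimes n}$ is the Hilbert space tensor power of $\mathcal{H}$, $\mathcal{H}^{\odot n}$ its closed subspace of symmetric tensors, and $\Sigma_n$ the group of permutations of $\{1,\dots,n\}$. For bounded operators $A_1,\dots,A_n$ on $\mathcal{H}$, the operator $\frac1{n!}\sum_{\pi\in\Sigma_n}A_{\pi(1)}\otimes\cdots\otimes A_{\pi(n)}$ on $\mathcal{H}^{\otimes n}$ leaves $\mathcal{H}^{\odot n}$ invariant, and $A_1\odot\cdots\odot A_n$ denotes its restriction to $\mathcal{H}^{\odot n}$; $\|A_1\odot\cdots\odot A_n\|$ is its operator norm. *)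

(* Defs.v *)
From HB Require Import structures.
From mathcomp Require Import all_boot all_order all_algebra all_fingroup.
From mathcomp Require Import complex.
From mathcomp Require Import all_classical all_reals all_analysis.

Set Implicit Arguments.
Unset Strict Implicit.
Unset Printing Implicit Defensive.

Import Order.TTheory GRing.Theory Num.Theory.
Import numFieldNormedType.Exports.

Local Open Scope classical_set_scope.
Local Open Scope ring_scope.
Local Open Scope complex_scope.

(* [{dot _ for _}] is linear in its first argument and conjugate-linear in the
   second; the norm of a normed module over R[i] takes values in R[i]. *)
Record hilbertSpace (R : realType) := HilbertSpace {
  hcarrier :> completeNormedModType R[i] ;
  hdot : {dot hcarrier for (@Num.conj R[i])} ;
  hdot_norm : forall x : hcarrier, hdot x x = `|x| ^+ 2
}.

Definition hnorm (R : realType) (H : hilbertSpace R) (x : H) : R :=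
  complex.Re `|x|.

Definition bounded_linear_op (R : realType) (H K : hilbertSpace R)
    (f : H -> K) : Prop :=
  linear f /\ exists M : R, forall x : H, hnorm (f x) <= M * hnorm x.

(* Supremum of |f t| over the unit ball of V; for f bounded and linear and V a
   linear subspace, it is the operator norm of the restriction of f to V. *)
Definition opnorm_on (R : realType) (H K : hilbertSpace R) (V : set H)
    (f : H -> K) : R :=
  sup [set r : R | exists t : H, [/\ V t, hnorm t <= 1 & r = hnorm (f t)]].

Definition tensor_span (R : realType) (n : nat) (H T : hilbertSpace R)
    (tens : ('I_n -> H) -> T) : set T :=
  [set t | exists (m : nat) (c : 'I_m -> R[i]) (x : 'I_m -> 'I_n -> H),
     t = \sum_(j < m) c j *: tens (x j)].

(* [is_tensor_power tens]: T is the n-th Hilbert space tensor power of H, the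
   elementary tensor of x_0, ..., x_(n-1) being [tens x]. These properties
   determine (T, tens) up to a unique unitary isomorphism. *)
Record is_tensor_power (R : realType) (n : nat) (H T : hilbertSpace R)
    (tens : ('I_n -> H) -> T) : Prop := IsTensorPower {
  tens_multilinear : forall (i : 'I_n) (x : 'I_n -> H),
    linear (fun u : H => tens (dfwith x i u)) ;
  tens_dot : forall x y : 'I_n -> H,
    hdot T (tens x) (tens y) = \prod_(i < n) hdot H (x i) (y i) ;
  tens_dense : dense (tensor_span tens)
}.

(* The bounded linear operator on T with the prescribed values f x on the
   elementary tensors [tens x]: it is unique when it exists, since elementary
   tensors span a dense subspace. The zero map when there is none. *)
Definition tensor_extension (R : realType) (n : nat) (H T : hilbertSpace R)
    (tens f : ('I_n -> H) -> T) : T -> T :=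
  xget (fun=> 0) [set S : T -> T |
    bounded_linear_op S /\ forall x : 'I_n -> H, S (tens x) = f x].

Definition tensor_op (R : realType) (n : nat) (H T : hilbertSpace R)
    (tens : ('I_n -> H) -> T) (A : 'I_n -> H -> H) : T -> T :=
  tensor_extension tens (fun x => tens (fun i => A i (x i))).

Definition tensor_perm (R : realType) (n : nat) (H T : hilbertSpace R)
    (tens : ('I_n -> H) -> T) (s : {perm 'I_n}) : T -> T :=
  tensor_extension tens (fun x => tens (fun i => x (s i))).

Definition symmetric_tensors (R : realType) (n : nat) (H T : hilbertSpace R)
    (tens : ('I_n -> H) -> T) : set T :=
  [set t | forall s : {perm 'I_n}, tensor_perm tens s t = t].

Definition symmetrized_op (R : realType) (n : nat) (H T : hilbertSpace R)
    (tens : ('I_n -> H) -> T) (A : 'I_n -> H -> H) : T -> T :=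
  fun t => (n`!%:R : R[i])^-1 *:
    \sum_(s : {perm 'I_n}) tensor_op tens (fun i => A (s i)) t.

Definition symmetric_product_norm (R : realType) (n : nat)
    (H T : hilbertSpace R) (tens : ('I_n -> H) -> T)
    (A : 'I_n -> H -> H) : R :=
  opnorm_on (symmetric_tensors tens) (symmetrized_op tens A).

(* Main.v *)
Require Import Defs.
From HB Require Import structures.
From mathcomp Require Import all_boot all_order all_algebra all_fingroup.
From mathcomp Require Import complex.
From mathcomp Require Import all_classical all_reals all_analysis.

(** For a unit vector x the tensor x ⊗ ... ⊗ x is a symmetric unit tensor, and
    A_1 ⊙ ... ⊙ A_n sends it to the average over the permutations s of the
    elementary tensors with factors A_(s i) x. Expanding the squared norm of
    this average gives per(G) / n!, where G is the Gram matrix of the vectors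
    A_i x and per is the permanent ([norm_symmetrized_op_diag]). Marcus'
    inequality per(G) >= \prod_i G i i for positive semidefinite G
    ([prod_diag_le_permanent]) bounds it below by \prod_i ‖A_i x‖^2 / n!, and
    the result follows by taking square roots and the supremum over x.

    Marcus' inequality is proved by setting to zero the off-diagonal entries of
    one row and column o at a time. This keeps G positive semidefinite and
    removes from the permanent exactly the terms of the permutations that move
    o. The sum of these terms is nonnegative: in the language of symmetric
    Fock space it is the squared norm of the vector obtained by applying to
    the product of the other n - 1 vectors the annihilation operator of the
    o-th one ([sum_moving_perm_ge0]).

    An operator norm is a supremum, so it dominates the values above only once
    the operator is known to be bounded, and the operators on the tensor power
    are specified only by their values on elementary tensors. Hence
    A_1 ⊗ ... ⊗ A_n has to be shown to exist as a bounded operator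
    ([tensor_opP]). With M_i a bound for A_i, the estimate
      ‖\sum_j c_j ⊗_i A_i x_ji‖ <= \prod_i |M_i| * ‖\sum_j c_j ⊗_i x_ji‖
    follows from Schur's product theorem: in each factor, M_i^2 times the Gram
    matrix of the x_ji exceeds the Gram matrix of the A_i x_ji by a positive
    semidefinite matrix, and such inequalities can be multiplied entrywise
    ([psd_prod_le]). The estimate also shows that the map is well defined on
    the dense span of the elementary tensors, and it extends by completeness
    ([dense_linear_extension]). *)

Set Implicit Arguments.
Unset Strict Implicit.
Unset Printing Implicit Defensive.

Import Order.TTheory GRing.Theory Num.Theory.
Import numFieldNormedType.Exports.

Local Open Scope classical_set_scope.
Local Open Scope complex_scope.
Local Open Scope sesquilinear_scope.
Local Open Scope ring_scope.

(** * Positive semidefinite kernels *)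

Section Psd.
Variable C : numClosedFieldType.

(** Positive semidefiniteness is expressed by a Gram factorization, which makes
    closure under entrywise products and reindexing immediate;
    [psd_form_ge0] and [form_ge0_psd] relate it to the quadratic form. *)
Definition psd (I : Type) (P : I -> I -> C) : Prop :=
  exists (J : finType) (V : J -> I -> C),
    forall i j, P i j = \sum_a V a i * (V a j)^*.

Lemma eq_psd (I : Type) (P Q : I -> I -> C) : P =2 Q -> psd P -> psd Q.
Proof. by move=> PQ [J [V PE]]; exists J, V => i j; rewrite -PQ. Qed.

Lemma psd_herm (I : Type) (P : I -> I -> C) i j : psd P -> (P i j)^* = P j i.
Proof.
move=> [J [V PE]]; rewrite !PE rmorph_sum; apply: eq_bigr => a _.
by rewrite rmorphM /= conjCK mulrC.
Qed.

Lemma psd_comp (I I' : Type) (f : I' -> I) (P : I -> I -> C) :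
  psd P -> psd (fun i j => P (f i) (f j)).
Proof. by move=> [J [V PE]]; exists J, (fun a i => V a (f i)) => i j; rewrite PE. Qed.

Lemma psd_const (I : Type) (c : C) : 0 <= c -> psd (fun _ _ : I => c).
Proof.
move=> c0; exists unit, (fun _ _ => sqrtC c) => _ _.
by rewrite big_const card_unit /= addr0 -normCK ger0_norm ?sqrtC_ge0 ?sqrtCK.
Qed.

Lemma psdD (I : Type) (P Q : I -> I -> C) :
  psd P -> psd Q -> psd (fun i j => P i j + Q i j).
Proof.
move=> [J [V PE]] [K [W QE]].
exists (J + K)%type, (fun a i => match a with inl b => V b i | inr b => W b i end).
by move=> i j; rewrite big_sumType /= PE QE.
Qed.

(** Schur's product theorem: factorizations multiply, the new index set being
    the product of the two index sets. *)
Lemma psdM (I : Type) (P Q : I -> I -> C) :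
  psd P -> psd Q -> psd (fun i j => P i j * Q i j).
Proof.
move=> [J [V PE]] [K [W QE]]; exists (J * K)%type, (fun a i => V a.1 i * W a.2 i).
move=> i j; rewrite PE QE big_distrlr pair_big /=; apply: eq_bigr => a _.
by rewrite rmorphM mulrACA.
Qed.

Lemma psd_prod (I K : Type) (s : seq K) (p : pred K) (P : K -> I -> I -> C) :
  (forall k, p k -> psd (P k)) -> psd (fun i j => \prod_(k <- s | p k) P k i j).
Proof.
move=> Pp; elim: s => [|k s IHs].
  by apply: eq_psd (psd_const I ler01) => i j; rewrite big_nil.
case pk: (p k); last by apply: eq_psd IHs => i j; rewrite big_cons pk.
by apply: eq_psd (psdM (Pp k pk) IHs) => i j; rewrite big_cons pk.
Qed.

(** Entrywise products are monotone for the order in which P dominates Q when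
    P - Q is positive semidefinite: telescope, replacing one factor at a time,
    so that each difference is a Schur product of positive matrices. *)
Lemma psd_prod_le (I K : Type) (s : seq K) (P Q : K -> I -> I -> C) :
  (forall k, psd (Q k)) -> (forall k, psd (fun i j => P k i j - Q k i j)) ->
  psd (fun i j => \prod_(k <- s) P k i j - \prod_(k <- s) Q k i j).
Proof.
move=> Qp PQ.
have Pp k : psd (P k) by apply: eq_psd (psdD (PQ k) (Qp k)) => i j; rewrite subrK.
elim: s => [|k s IHs].
  by apply: eq_psd (psd_const I (lexx _)) => i j; rewrite !big_nil subrr.
have PQs : psd (fun i j => (P k i j - Q k i j) * \prod_(l <- s) P l i j).
  by apply: psdM => //; apply: psd_prod.
apply: eq_psd (psdD PQs (psdM (Qp k) IHs)) => i j.
by rewrite !big_cons mulrBl mulrBr addrA subrK.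
Qed.

Lemma psd_form_ge0 (I : finType) (P : I -> I -> C) (p : pred I) (c : I -> C) :
  psd P -> 0 <= \sum_(i | p i) \sum_(j | p j) c i * (c j)^* * P i j.
Proof.
move=> [J [V PE]].
have -> : \sum_(i | p i) \sum_(j | p j) c i * (c j)^* * P i j =
    \sum_a `|\sum_(i | p i) c i * V a i| ^+ 2.
  under [RHS]eq_bigr => a _ do
    rewrite normCK rmorph_sum big_distrlr /=.
  rewrite [RHS]exchange_big /=; apply: eq_bigr => i _.
  rewrite [RHS]exchange_big /=; apply: eq_bigr => j _.
  by rewrite PE mulr_sumr; apply: eq_bigr => a _; rewrite rmorphM mulrACA.
by apply: sumr_ge0 => a _; rewrite exprn_ge0.
Qed.

(** The spectral theorem: diagonalize by a unitary matrix and take square roots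
    of the eigenvalues, which are values of the quadratic form. *)
Lemma form_ge0_psd (I : finType) (P : I -> I -> C) :
  (forall i j, (P i j)^* = P j i) ->
  (forall c : I -> C, 0 <= \sum_i \sum_j c i * (c j)^* * P i j) ->
  psd P.
Proof.
move=> Pherm Ppos.
pose A : 'M[C]_#|I| := \matrix_(i, j) P (enum_val i) (enum_val j).
have Anormal : A \is normalmx.
  apply: hermitian_normalmx; apply/is_hermitianmxP.
  by rewrite expr0 scale1r; apply/matrixP => i j; rewrite !mxE Pherm.
have := orthomx_spectralP Anormal.
set U := spectralmx A; set d := spectral_diag A.
have Uu : U \is unitarymx := spectral_unitarymx A.
rewrite invmx_unitary // => AE.
have AijE i j : A i j = \sum_a d 0 a * (U a i)^* * U a j.
  rewrite {1}AE -mulmxA mxE; apply: eq_bigr => a _.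
  by rewrite mul_diag_mx !mxE mulrCA mulrA.
have dE a : d 0 a = \sum_i \sum_j U a i * (U a j)^* * A i j.
  have -> : d 0 a = (U *m A *m U^t*) a a.
    rewrite AE !mulmxA (unitarymxP Uu) mul1mx -mulmxA (unitarymxP Uu) mulmx1.
    by rewrite mxE eqxx mulr1n.
  rewrite mxE exchange_big /=; apply: eq_bigr => j _.
  rewrite mxE mulr_suml; apply: eq_bigr => i _.
  by rewrite !mxE mulrAC.
have d_ge0 a : 0 <= d 0 a.
  rewrite dE; have := Ppos (fun i => U a (enum_rank i)).
  rewrite (reindex (@enum_val I predT)) /=; last exact: onW_bij (enum_val_bij _).
  congr (_ <= _); apply: eq_bigr => i _.
  rewrite (reindex (@enum_val I predT)) /=; last exact: onW_bij (enum_val_bij _).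
  by apply: eq_bigr => j _; rewrite !enum_valK mxE.
exists 'I_#|I|, (fun a i => sqrtC (d 0 a) * (U a (enum_rank i))^*) => i j.
have -> : P i j = A (enum_rank i) (enum_rank j) by rewrite mxE !enum_rankK.
rewrite AijE; apply: eq_bigr => a _.
rewrite rmorphM /= conjCK mulrACA -normCK ger0_norm ?sqrtC_ge0 // sqrtCK.
by rewrite mulrA.
Qed.
End Psd.

(** * Marcus' inequality for permanents *)

Section Permanent.
Variables (C : numClosedFieldType) (I : finType).
Implicit Type G : I -> I -> C.

Definition permanent G : C := \sum_(s : {perm I}) \prod_i G i (s i).

(** [decouple o G] is the direct sum of the diagonal entry of G at o and of the
    complementary principal submatrix, kept on the same index set. *)
Definition decouple (o : I) G : I -> I -> C :=
  fun i j => if (i == o) == (j == o) then G i j else 0.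

Lemma psd_decouple o G : psd G -> psd (decouple o G).
Proof.
move=> Gp.
(* Entrywise product with the Gram matrix of vectors taken from an
   orthonormal pair according to whether the index is o. *)
have Dp : psd (fun i j => ((i == o) == (j == o))%:R : C).
  exists bool, (fun a i => (a == (i == o))%:R) => i j.
  rewrite big_bool !rmorph_nat /= -!natrM -natrD.
  by case: (i == o); case: (j == o).
apply: eq_psd (psdM Gp Dp) => i j; rewrite /decouple.
by case: ifP => _; rewrite ?mulr1 ?mulr0.
Qed.

Lemma permanent_decouple o G :
  permanent (decouple o G) = \sum_(s : {perm I} | s o == o) \prod_i G i (s i).
Proof.
rewrite [RHS]big_mkcond; apply: eq_bigr => s _; case: eqP => [so|/eqP so].
  apply: eq_bigr => i _; rewrite /decouple.
  by rewrite -[X in s i == X]so (inj_eq perm_inj) eqxx.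
by rewrite (bigD1 o) //= {1}/decouple eqxx (negPf so) mul0r.
Qed.

(** A permutation s moving o is, uniquely, the transposition of o and
    k = s^-1 o followed by a permutation t fixing o: that is, s is obtained from
    t by inserting o into a cycle, between k and t k. *)
Lemma sum_moving_perm o G :
  \sum_(s : {perm I} | s o != o) \prod_i G i (s i) =
  \sum_(k | k != o) \sum_(t : {perm I} | t o == o)
    G k o * G o (t k) * \prod_(i | (i != o) && (i != k)) G i (t i).
Proof.
rewrite (partition_big (fun s : {perm I} => (s^-1)%g o) (fun k => k != o)) /=.
  apply: eq_bigr => k ko.
  rewrite (reindex_inj (mulgI (tperm o k))) /=; apply: eq_big => t.
    rewrite invMg !permM tpermV tpermL; apply/andP/eqP => [[_]|to].
      by rewrite (canF_eq (tpermK _ _)) tpermR => /eqP to; rewrite -{1}to permKV.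
    rewrite -[X in _ != X]to (inj_eq perm_inj) ko; split=> //.
    by rewrite -{2}to permK tpermL.
  rewrite invMg !permM tpermV tpermL => /andP[_].
  rewrite (canF_eq (tpermK _ _)) tpermR => /eqP to'.
  have to : t o = o by rewrite -{1}to' permKV.
  rewrite (bigD1 o) //= (bigD1 k) //= !permM tpermL tpermR to mulrA.
  rewrite [X in X * _]mulrC; congr (_ * _); apply: eq_bigr => i /andP[io ik].
  by rewrite permM tpermD // eq_sym.
move=> s so; apply: contra so => /eqP so.
by rewrite -{1}so permKV.
Qed.

(** Let S be the stabilizer of o. For fixed k distinct from o, the matrix indexed
    by a and b in S whose entries are the products of the G (a i) (b i) over i
    distinct from o and k is positive semidefinite, so its quadratic form at the
    vector (G (a k) o)_a is nonnegative. Writing b i = t (a i), the sum of these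
    forms over k is #|S| times the sum of [sum_moving_perm]. *)
Lemma sum_moving_perm_ge0 o G : psd G ->
  0 <= \sum_(s : {perm I} | s o != o) \prod_i G i (s i).
Proof.
move=> Gp; rewrite sum_moving_perm.
set R := (X in 0 <= X).
pose stab := [pred a : {perm I} | a o == o].
have stab_gt0 : (0 < #|stab|)%N by apply/card_gt0P; exists 1%g; rewrite inE perm1.
rewrite -(pmulrn_lge0 _ stab_gt0) -sumr_const.
have -> : \sum_(a in stab) R = \sum_(k | k != o) \sum_(a in stab)
    \sum_(b in stab) G (a k) o * (G (b k) o)^* *
      \prod_(i | (i != o) && (i != k)) G (a i) (b i).
  rewrite [RHS]exchange_big /=; apply: eq_bigr => a; rewrite inE => /eqP ao.
  have aN i : (a i != o) = (i != o) by rewrite -[X in _ != X]ao (inj_eq perm_inj).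
  rewrite /R (reindex_inj (@perm_inj _ a)) /=; apply: eq_big => // k ko.
  rewrite [RHS](reindex_inj (mulgI a)) /=; apply: eq_big => t.
    by rewrite inE permM ao.
  move=> to; rewrite permM (psd_herm _ _ Gp); congr (_ * _).
  rewrite (reindex_inj (@perm_inj _ a)) /=; apply: eq_big => i.
    by rewrite aN (inj_eq perm_inj).
  by rewrite permM.
apply: sumr_ge0 => k _; apply: (psd_form_ge0 _ (fun a : {perm I} => G (a k) o)).
apply: psd_prod => i _; exact: (psd_comp (fun a : {perm I} => a i)).
Qed.

Lemma permanent_decouple_le o G : psd G -> permanent (decouple o G) <= permanent G.
Proof.
move=> Gp; rewrite permanent_decouple /permanent.
rewrite [leRHS](bigID (fun s : {perm I} => s o == o)) /= lerDl.
exact: sum_moving_perm_ge0.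
Qed.

(** Marcus' inequality: decoupling every index leaves the diagonal part of G,
    whose permanent is the product of the diagonal entries. *)
Theorem prod_diag_le_permanent G : psd G -> \prod_i G i i <= permanent G.
Proof.
move=> Gp.
have dec_le (r : seq I) : psd (foldr decouple G r) /\
    permanent (foldr decouple G r) <= permanent G.
  elim: r => [|o r [IHp IHle]] //=; split; first exact: psd_decouple.
  exact: le_trans (permanent_decouple_le _ IHp) IHle.
have decE (r : seq I) i j : foldr decouple G r i j =
    if all (fun o => (i == o) == (j == o)) r then G i j else 0.
  by elim: r => [|o r IHr] //=; rewrite {1}/decouple IHr; case: (_ == _).
have [_] := dec_le (enum I).
(* Only the identity contributes to the permanent of a diagonal matrix. *)
congr (_ <= _).
rewrite /permanent (bigD1 1%g) //= [X in _ + X]big1 ?addr0.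
  by apply: eq_bigr => i _; rewrite decE perm1; case: allP => // -[] o _; rewrite eqxx.
move=> s s1; have [i si] : exists i, s i != i.
  apply/existsP; apply: contraNT s1; rewrite negb_exists => /forallP sE.
  by apply/eqP/permP => i; rewrite perm1; apply/eqP; have := sE i; rewrite negbK.
rewrite (bigD1 i) //= decE; case: allP => [/(_ i)|_]; last by rewrite mul0r.
by rewrite mem_enum eqxx (negPf si) => /(_ isT).
Qed.
End Permanent.

(** * Extension of densely defined bounded operators *)

Section LinearExtension.
(** The densely defined operator is given by its graph G. The bound makes G
    single-valued: by linearity two values at u differ by at most M * 0. *)
Variables (K : numFieldType) (V : normedModType K) (W : completeNormedModType K).
Variables (G : V -> W -> Prop) (M : K).
Hypothesis M_ge0 : 0 <= M.
Hypothesis G_linear : forall a u w u' w',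
  G u w -> G u' w' -> G (a *: u + u') (a *: w + w').
Hypothesis G_bounded : forall u w, G u w -> `|w| <= M * `|u|.
Hypothesis G_dense : dense [set u | exists w, G u w].

(** Membership of (t, v) in the closure of G: the closure turns out to be the
    graph of the extension. *)
Let adherent (t : V) (v : W) := forall e : K, 0 < e ->
  exists u w, [/\ G u w, `|t - u| < e & `|v - w| < e].

Let G_adherent u w : G u w -> adherent u w.
Proof. by move=> Guw e e0; exists u, w; rewrite !subrr !normr0. Qed.

Let adherent_linear a t v t' v' :
  adherent t v -> adherent t' v' -> adherent (a *: t + t') (a *: v + v').
Proof.
move=> tv tv' e e0.
have a1 : 0 < `|a| + 1 by rewrite ltr_wpDl.
pose d := e / (`|a| + 1).
have d0 : 0 < d by rewrite divr_gt0.
have [u [w [Guw tu vw]]] := tv d d0.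
have [u' [w' [Guw' tu' vw']]] := tv' d d0.
have small (X : normedModType K) (x x' y y' : X) :
    `|x - y| < d -> `|x' - y'| < d -> `|a *: x + x' - (a *: y + y')| < e.
  move=> xy xy'; rewrite opprD addrACA -scalerBr.
  rewrite (le_lt_trans (ler_normD _ _)) // normrZ.
  have -> : e = `|a| * d + d by rewrite -[X in _ + X]mul1r -mulrDl mulrC divfK ?gt_eqF.
  by rewrite ler_ltD // ler_wpM2l // ltW.
by exists (a *: u + u'), (a *: w + w'); split; [exact: G_linear|exact: small|exact: small].
Qed.

Let adherent_bounded t v : adherent t v -> `|v| <= M * `|t|.
Proof.
move=> tv; apply/ler_addgt0Pr => e e0.
have M1 : 0 < M + 1 by rewrite ltr_wpDl.
have [u [w [Guw tu vw]]] := tv (e / (M + 1)) (divr_gt0 e0 M1).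
rewrite -[v](subrK w) (le_trans (ler_normD _ _)) //.
have uB : `|u| <= `|t| + e / (M + 1).
  rewrite -[u](subrK t) addrC (le_trans (ler_normD _ _)) // lerD2l distrC.
  exact: ltW.
have wB : `|w| <= M * `|t| + M * (e / (M + 1)).
  by rewrite -mulrDr (le_trans (G_bounded Guw)) // ler_wpM2l.
rewrite (le_trans (lerD (ltW vw) wB)) // addrCA lerD2l.
by rewrite -[X in X + _]mul1r -mulrDl addrC mulrC divfK ?gt_eqF.
Qed.

Let adherent_unique t v v' : adherent t v -> adherent t v' -> v = v'.
Proof.
move=> tv tv'; have /adherent_bounded := adherent_linear (-1) tv' tv.
rewrite !scaleN1r addNr normr0 mulr0 normr_le0 addrC subr_eq0 => /eqP//.
Qed.

(** The values of G at points close to t form a Cauchy filter base, since G is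
    Lipschitz; its limit is the value at t. *)
Let adherent_exists t : exists v, adherent t v.
Proof.
pose B (e : K) := [set w | exists2 u, G u w & `|t - u| < e].
pose F := filter_from [set e : K | 0 < e] B.
have F_filter : Filter F.
  apply: filter_from_filter; first by exists 1 => /=.
  move=> i j i0 j0; have : (i <= j) || (j <= i) by rewrite real_leVge ?gtr0_real.
  case/orP => [ij|ji]; [exists i|exists j] => // w [u Guw tu];
    by split; exists u => //; apply: lt_le_trans tu _.
have F_proper : ProperFilter F.
  apply: filter_from_proper => // e e0.
  have [|u] := G_dense _ (ball_open t e); first by exists t; exact: ballxx.
  by rewrite -ball_normE => -[tu [w Guw]]; exists w, u.
have Fcvg : cvg F.
  apply: cauchy_cvg; apply: cauchy_exP => e e0.
  have M1 : 0 < M + 1 by rewrite ltr_wpDl.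
  pose d := e / 2 / (M + 1).
  have d0 : 0 < d by rewrite !divr_gt0.
  have [w0 [u0 Guw0 tu0]] := @filter_ex _ F _ (B d) (ex_intro2 _ _ d d0 (fun _ => id)).
  exists w0, d => // w [u Guw tu].
  rewrite -ball_normE /=.
  have := G_bounded (G_linear (-1) Guw Guw0).
  rewrite !scaleN1r [- w + _]addrC [- u + _]addrC => /le_lt_trans; apply.
  have uu0 : `|u0 - u| <= d + d.
    rewrite -[u0](subrK t) -addrA (le_trans (ler_normD _ _)) // distrC.
    by rewrite lerD // ltW.
  rewrite (le_lt_trans (ler_wpM2l M_ge0 uu0)) //.
  rewrite -mulr2n -mulr_natr mulrA (@lt_le_trans _ _ ((M + 1) * d * 2)) //.
    by rewrite ltr_pM2r // ltr_pM2r // ltrDl.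
  by rewrite /d [(M + 1) * _]mulrC divfK ?gt_eqF // divfK.
exists (lim F) => e e0.
have /fcvgrPdist_lt/(_ e e0) Fe := Fcvg.
have FB : F (B e) by exists e.
have [w [vw [u Guw tu]]] := filter_ex (filterI Fe FB).
by exists u, w.
Qed.

Lemma dense_linear_extension : exists S : V -> W,
  [/\ linear S, forall t, `|S t| <= M * `|t| & forall u w, G u w -> S u = w].
Proof.
have [S SP] := choice adherent_exists.
exists S; split=> [a t t'|t|u w Guw].
- exact: adherent_unique (SP _) (adherent_linear a (SP t) (SP t')).
- exact: adherent_bounded.
- exact: adherent_unique (SP u) (G_adherent Guw).
Qed.
End LinearExtension.

(** * Gram matrices in Hilbert spaces *)

Section Hilbert.
Variable R : realType.
Implicit Types H K : hilbertSpace R.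

Lemma hnormE H (x : H) : (hnorm x)%:C = `|x|.
Proof. by rewrite /hnorm RRe_real. Qed.

Lemma hnorm_ge0 H (x : H) : 0 <= hnorm x.
Proof. by rewrite -lecR hnormE normr_ge0. Qed.

Lemma hnorm_le H K (M : R) (x : H) (y : K) :
  (hnorm y <= M * hnorm x) = (`|y| <= M%:C * `|x|).
Proof. by rewrite -lecR rmorphM /= !hnormE. Qed.

Lemma hdot_conj H (x y : H) : (hdot H x y)^* = hdot H y x.
Proof. by rewrite [RHS]hermC expr0 mul1r. Qed.

Lemma hdot_sum H (I : finType) (c : I -> R[i]) (x : I -> H) :
  hdot H (\sum_i c i *: x i) (\sum_i c i *: x i) =
  \sum_i \sum_j c i * (c j)^* * hdot H (x i) (x j).
Proof.
rewrite linear_sumlz; apply: eq_bigr => i _.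
rewrite linear_sumr; apply: eq_bigr => j _.
by rewrite linearZl_LR linearZr_LR /= mulrA.
Qed.

Lemma psd_gram H (I : finType) (x : I -> H) : psd (fun i j => hdot H (x i) (x j)).
Proof.
apply: form_ge0_psd => [i j|c]; first exact: hdot_conj.
by rewrite -hdot_sum hdot_norm exprn_ge0.
Qed.

Lemma linear_comb H K (f : H -> K) (I : finType)
    (c : I -> R[i]) (x : I -> H) : linear f ->
  f (\sum_i c i *: x i) = \sum_i c i *: f (x i).
Proof.
move=> fL; pose g := GRing.isLinear.Build _ _ _ _ f fL.
pose f' : {linear H -> K} := HB.pack f g.
rewrite -[f]/(f' : H -> K) linear_sum; apply: eq_bigr => i _.
by rewrite linearZ.
Qed.

(** The quadratic form at c is M^2 ‖u‖^2 - ‖f u‖^2 with u the combination of the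
    x_i with coefficients c. *)
Lemma psd_gram_defect H K (f : H -> K) (M : R) (I : finType)
    (x : I -> H) : linear f -> (forall x, hnorm (f x) <= M * hnorm x) ->
  psd (fun i j => M%:C ^+ 2 * hdot H (x i) (x j) - hdot K (f (x i)) (f (x j))).
Proof.
move=> fL fM; apply: form_ge0_psd => [i j|c].
  rewrite rmorphB rmorphM; congr (_ * _ - _); try exact: hdot_conj.
  by rewrite rmorphXn /= conj_Creal // complex_real.
have -> : \sum_i \sum_j c i * (c j)^* *
      (M%:C ^+ 2 * hdot H (x i) (x j) - hdot K (f (x i)) (f (x j))) =
    M%:C ^+ 2 * hdot H (\sum_i c i *: x i) (\sum_i c i *: x i)
    - hdot K (f (\sum_i c i *: x i)) (f (\sum_i c i *: x i)).
  rewrite linear_comb // !hdot_sum mulr_sumr -sumrB; apply: eq_bigr => i _.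
  rewrite mulr_sumr -sumrB; apply: eq_bigr => j _.
  by rewrite mulrBr mulrCA.
set u := \sum_i _.
have fu : `|f u| <= M%:C * `|u| by rewrite -hnorm_le.
by rewrite !hdot_norm subr_ge0 -exprMn lerXn2r ?nnegrE ?(le_trans _ fu).
Qed.
End Hilbert.

(** * Operators on the tensor power *)

Section TensorPower.
Variables (R : realType) (n : nat) (H T : hilbertSpace R) (tens : ('I_n -> H) -> T).
Hypothesis htens : is_tensor_power tens.

(** [tensor_extension] is a default value unless a bounded operator with the
    prescribed values exists; a uniform estimate on the span of the elementary
    tensors provides one. *)
Lemma tensor_extensionP (f : ('I_n -> H) -> T) (M : R) : 0 <= M ->
  (forall m (c : 'I_m -> R[i]) (x : 'I_m -> 'I_n -> H),
    `|\sum_j c j *: f (x j)| <= M%:C * `|\sum_j c j *: tens (x j)|) ->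
  bounded_linear_op (tensor_extension tens f) /\
  forall x, tensor_extension tens f (tens x) = f x.
Proof.
move=> M0 fM; apply: (@xgetPex _ (fun=> 0) [set S : T -> T |
    bounded_linear_op S /\ forall x, S (tens x) = f x]).
pose G (u w : T) := exists m (c : 'I_m -> R[i]) (x : 'I_m -> 'I_n -> H),
  u = \sum_j c j *: tens (x j) /\ w = \sum_j c j *: f (x j).
have [| | | |S [SL SM SG]] := @dense_linear_extension R[i] T T G M%:C.
- by rewrite lecR.
- move=> a u w u' w' [m [c [x [-> ->]]]] [m' [c' [x' [-> ->]]]].
  exists (m + m')%N,
    (fun j => match fintype.split j with inl i => a * c i | inr i => c' i end),
    (fun j => match fintype.split j with inl i => x i | inr i => x' i end).
  rewrite !big_split_ord !scaler_sumr /=.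
  by split; congr (_ + _); apply: eq_bigr => j _;
    rewrite ?(unsplitK (inl _)) ?(unsplitK (inr _)) ?scalerA.
- by move=> u w [m [c [x [-> ->]]]].
- move=> O O0 oO; have [u [Ou [m [c [x ux]]]]] := tens_dense htens O0 oO.
  by exists u; split=> //; exists (\sum_j c j *: f (x j)), m, c, x.
exists S; split=> [|x]; first by split=> //; exists M => t; rewrite hnorm_le.
apply: SG; exists 1%N, (fun=> 1), (fun=> x).
by rewrite !big_ord1 !scale1r.
Qed.

(** The squared norms of the two combinations are the values at c of the
    quadratic forms of the entrywise products of the Gram matrices of the
    factors, which [psd_prod_le] compares. *)
Lemma tensor_opP (A : 'I_n -> H -> H) : (forall i, bounded_linear_op (A i)) ->
  bounded_linear_op (tensor_op tens A) /\
  forall x, tensor_op tens A (tens x) = tens (fun i => A i (x i)).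
Proof.
move=> hA; have /choice[M AM] := fun i => (hA i).2.
apply: (@tensor_extensionP _ (\prod_i `|M i|)).
  by apply: prodr_ge0.
move=> m c x.
rewrite -(@ler_pXn2r _ 2) ?nnegrE ?mulr_ge0 ?lecR ?prodr_ge0 //.
rewrite exprMn -!hdot_norm -subr_ge0 !hdot_sum.
have Dp := psd_prod_le (index_enum 'I_n)
  (fun k => psd_gram (fun j => A k (x j k)))
  (fun k => psd_gram_defect (fun j => x j k) (hA k).1 (AM k)).
have := psd_form_ge0 predT c Dp; congr (_ <= _).
rewrite mulr_sumr -sumrB; apply: eq_bigr => i _.
rewrite mulr_sumr -sumrB; apply: eq_bigr => j _.
rewrite !(tens_dot htens) mulrBr [_ ^+ 2 * _]mulrCA; congr (_ * _ - _).
rewrite big_split; congr (_ * _).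
rewrite rmorph_prod -prodrXl /=; apply: eq_bigr => k _.
by rewrite -!rmorphXn /= real_normK // num_real.
Qed.

Lemma tensor_permP (s : {perm 'I_n}) (x : 'I_n -> H) :
  tensor_perm tens s (tens x) = tens (fun i => x (s i)).
Proof.
apply: (proj2 (@tensor_extensionP (fun x => tens (fun i => x (s i))) 1 ler01 _)).
move=> m c {}x; rewrite mul1r.
rewrite -(@ler_pXn2r _ 2) ?nnegrE // -!hdot_norm !hdot_sum le_eqVlt.
apply/orP; left; apply/eqP; apply: eq_bigr => i _; apply: eq_bigr => j _.
rewrite !(tens_dot htens) [in RHS](reindex_inj (@perm_inj _ s)).
by [].
Qed.

Lemma symmetric_tens_diag x : symmetric_tensors tens (tens (fun=> x)).
Proof. by move=> s; rewrite tensor_permP. Qed.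

Lemma hnorm_tens_diag x : hnorm (tens (fun=> x)) = hnorm x ^+ n.
Proof.
apply: (@pexpIrn _ 2); rewrite ?nnegrE ?exprn_ge0 ?hnorm_ge0 //.
apply: (@complexI R); rewrite !rmorphXn /= !hnormE -hdot_norm (tens_dot htens).
by rewrite prodr_const card_ord hdot_norm exprAC.
Qed.

Variable A : 'I_n -> H -> H.
Hypothesis hA : forall i, bounded_linear_op (A i).

Lemma symmetrized_op_diag x :
  symmetrized_op tens A (tens (fun=> x)) =
  (n`!%:R : R[i])^-1 *: \sum_(s : {perm 'I_n}) tens (fun i => A (s i) x).
Proof.
congr (_ *: _); apply: eq_bigr => s _.
by rewrite (proj2 (tensor_opP (fun i => hA (s i)))).
Qed.

(** Expanding the inner product gives a double sum over permutations s and s',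
    whose terms depend on s^-1 s' only: hence n! copies of the permanent. *)
Lemma norm_symmetrized_op_diag x :
  `|symmetrized_op tens A (tens (fun=> x))| ^+ 2 =
  (n`!%:R)^-1 * permanent (fun i j => hdot H (A i x) (A j x)).
Proof.
rewrite symmetrized_op_diag scaler_sumr -hdot_norm hdot_sum.
have n0 : n`!%:R != 0 :> R[i] by rewrite pnatr_eq0 -lt0n fact_gt0.
rewrite fmorphV rmorph_nat.
rewrite (eq_bigr (fun=> (n`!%:R)^-1 * (n`!%:R)^-1 *
   permanent (fun i j => hdot H (A i x) (A j x)))).
  by rewrite sumr_const card_Sn -[LHS]mulr_natl -mulrA mulVKf.
move=> s _; rewrite -mulr_sumr (reindex_inj (mulgI s)); congr (_ * _).
apply: eq_bigr => t _.
rewrite (tens_dot htens) [RHS](reindex_inj (@perm_inj _ s)).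
by apply: eq_bigr => i _; rewrite permM.
Qed.

Lemma symmetrized_op_diag_ge x :
  (Num.sqrt (n`!%:R : R))^-1 * \prod_(i < n) hnorm (A i x) <=
  hnorm (symmetrized_op tens A (tens (fun=> x))).
Proof.
have le0 : 0 <= (Num.sqrt (n`!%:R : R))^-1 * \prod_(i < n) hnorm (A i x).
  by rewrite mulr_ge0 ?invr_ge0 ?sqrtr_ge0 // prodr_ge0 // => i _; exact: hnorm_ge0.
rewrite -(@ler_pXn2r _ 2) ?nnegrE ?hnorm_ge0 //.
rewrite exprMn exprVn sqr_sqrtr ?ler0n // -prodrXl.
rewrite -lecR [leRHS]rmorphXn /= hnormE norm_symmetrized_op_diag.
rewrite rmorphM fmorphV rmorph_nat /=.
rewrite ler_wpM2l ?invr_ge0 ?ler0n //.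
rewrite (le_trans _ (prod_diag_le_permanent (psd_gram (A^~ x)))) //.
rewrite rmorph_prod le_eqVlt; apply/orP; left; apply/eqP.
by apply: eq_bigr => i _; rewrite rmorphXn /= hnormE hdot_norm.
Qed.

Lemma symmetrized_op_bounded :
  exists M : R, forall t, hnorm (symmetrized_op tens A t) <= M * hnorm t.
Proof.
have /choice[M AM] := fun s : {perm 'I_n} => (tensor_opP (fun i => hA (s i))).1.2.
exists ((n`!%:R)^-1 * \sum_s M s) => t.
rewrite hnorm_le normrZ normfV normr_nat rmorphM fmorphV rmorph_nat -mulrA.
rewrite ler_wpM2l ?invr_ge0 ?ler0n // (le_trans (ler_norm_sum _ _ _)) //.
by rewrite rmorph_sum mulr_suml ler_sum // => s _; rewrite -hnorm_le.
Qed.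
End TensorPower.

Theorem proposition4p4 (R : realType) (H : hilbertSpace R) (n : nat)
    (hn : (1 <= n)%N)
    (T : hilbertSpace R) (tens : ('I_n -> H) -> T)
    (htens : is_tensor_power tens)
    (A : 'I_n -> H -> H) (hA : forall i : 'I_n, bounded_linear_op (A i)) :
  (Num.sqrt (n`!%:R : R))^-1 *
    sup [set r : R | exists2 x : H,
           hnorm x = 1 & r = \prod_(i < n) hnorm (A i x)]
  <= symmetric_product_norm tens A.
Proof.
have sqrt_gt0 : 0 < Num.sqrt (n`!%:R : R) by rewrite sqrtr_gt0 ltr0n fact_gt0.
have [M symM] := symmetrized_op_bounded htens hA.
rewrite mulrC ler_pdivrMr //.
have value_le t : symmetric_tensors tens t -> hnorm t <= 1 ->
    hnorm (symmetrized_op tens A t) <= symmetric_product_norm tens A.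
  move=> tsym t1; apply: ub_le_sup; last by exists t.
  exists `|M| => _ [u [_ u1 ->]]; rewrite (le_trans (symM u)) //.
  rewrite (le_trans (ler_wpM2r (hnorm_ge0 u) (ler_norm M))) //.
  by rewrite ler_piMr.
have diag_le x : hnorm x <= 1 ->
    hnorm (symmetrized_op tens A (tens (fun=> x))) <= symmetric_product_norm tens A.
  move=> x1; apply: value_le; first exact: symmetric_tens_diag.
  by rewrite hnorm_tens_diag // exprn_ile1 ?hnorm_ge0.
(* When H has no unit vector the supremum is 0 by convention; the right-hand
   side is then nonnegative because the tensor of the zero vector is in the
   unit ball. *)
set S := [set r | _]; have [->|S0] := eqVneq S set0.
  rewrite sup0 mulr_ge0 ?sqrtr_ge0 // (le_trans _ (diag_le 0 _)) ?hnorm_ge0 //.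
  by rewrite -lecR hnormE normr0 ler01.
apply: ge_sup; first exact/set0P.
move=> _ [x x1 ->]; rewrite -ler_pdivrMr // mulrC.
by rewrite (le_trans (symmetrized_op_diag_ge htens hA x)) // diag_le ?x1.
Qed.
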